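(* Let $x>0$. For any $p\in(0,1)$, $$\dim_{\mathrm H}\bigl(\Lambda_p(x)\bigr)\ \ge\ \frac{\mathrm h(p,1-p)}{\log 3},$$ where $\mathrm h(p,1-p):=-p\log p-(1-p)\log(1-p)$.
   Context: For $\lambda>0$, $E_\lambda=\left\{\frac{\lambda}{2}\sum_{i=1}^\infty d_i/3^i : d_i\in\{0,2\}\right\}$ (the self-similar set of the maps $t\mapsto t/3$ and $t\mapsto (t+\lambda)/3$). For $x>0$, $\Lambda(x)=\{\lambda>0 : x\in E_\lambda\}$. Let $\Omega=\{0,2\}^{\mathbb N}$. For $\lambda\in\Lambda(x)$, $\Phi_x(\lambda)$ denotes the (unique) sequence $(d_i)\in\Omega$ with $x=\frac{\lambda}{2}\sum_{i=1}^\infty d_i/3^i$. For $(d_n)\in\Omega$ and $i\in\{0,2\}$, $freq_i((d_n))=\lim_{n\to\infty}\frac{\#\{1\le k\le n: d_k=i\}}{n}$ when this limit exists. Define $\Lambda_p(x)=\{\lambda\in\Lambda(x): freq_2\,\Phi_x(\lambda)=p,\ freq_0\,\Phi_x(\lambda)=1-p\}$ (in particular the limits are required to exist). $\dim_{\mathrm H}$ denotes Hausdorff dimension. *)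

(* Defs.v *)
From HB Require Import structures.
From mathcomp Require Import all_boot all_order all_algebra.
From mathcomp Require Import all_classical all_reals all_analysis.

Set Implicit Arguments.
Unset Strict Implicit.
Unset Printing Implicit Defensive.

Import Order.TTheory GRing.Theory Num.Theory.
Import numFieldNormedType.Exports.

Local Open Scope classical_set_scope.
Local Open Scope ring_scope.

(* The [maxe 0] gives the empty set diameter 0. *)
Definition diam (R : realType) (A : set R) : \bar R :=
  maxe 0%E (ereal_sup [set (`|a.1 - a.2|)%:E | a in A `*` A]).

(* [0 `^ 0 = 1], so the empty set is treated apart: it contributes nothing to a
   cover, and the 0-dimensional Hausdorff measure is the counting measure. *)
Definition hausdorff_weight (R : realType) (s : R) (A : set R) : \bar R :=
  if `[< A = set0 >] then 0%E else (diam A `^ s)%E.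

Definition hausdorff_premeasure (R : realType) (s delta : R) (A : set R)
    : \bar R :=
  ereal_inf [set (\sum_(0 <= k <oo) hausdorff_weight s (U k))%E
    | U in [set U : nat -> set R |
        A `<=` \bigcup_k U k /\ forall k, (diam (U k) <= delta%:E)%E]].

Definition hausdorff_measure (R : realType) (s : R) (A : set R) : \bar R :=
  ereal_sup [set hausdorff_premeasure s delta A
    | delta in [set delta : R | 0 < delta]].

Definition hausdorff_dim (R : realType) (A : set R) : \bar R :=
  ereal_inf [set s%:E
    | s in [set s : R | 0 <= s /\ hausdorff_measure s A = 0%E]].

(* Sequences are indexed from 0: [d i] is the digit d_{i+1}. *)
Definition Omega : set (nat -> nat) :=
  [set d | forall i, d i = 0%N \/ d i = 2%N].

Definition coding (R : realType) (lambda : R) (d : nat -> nat) : R :=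
  lambda / 2 * limn (series (fun i => (d i)%:R / 3 ^+ i.+1 : R)).

Definition Eset (R : realType) (lambda : R) : set R :=
  [set coding lambda d | d in Omega].

Definition Lambda (R : realType) (x : R) : set R :=
  [set lambda | 0 < lambda /\ x \in Eset lambda].

(* For [lambda \in Lambda x] the set below is a singleton; elsewhere the value
   is irrelevant. *)
Definition Phi (R : realType) (x lambda : R) : nat -> nat :=
  xget (fun=> 0%N) [set d | Omega d /\ x = coding lambda d].

(* The limit defining freq_i(d) exists and equals [q]. *)
Definition has_freq (R : realType) (i : nat) (d : nat -> nat) (q : R) : Prop :=
  (fun n : nat => (count (fun k => d k == i) (iota 0 n))%:R / n%:R : R)
    @ \oo --> q.

Definition Lambda_freq (R : realType) (p x : R) : set R :=
  [set lambda | [/\ lambda \in Lambda x,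
                    has_freq 2 (Phi x lambda) p &
                    has_freq 0 (Phi x lambda) (1 - p)]].

Definition entropy (R : realType) (p q : R) : R := - p * ln p - q * ln q.

(* Main.v *)
(* Each [lambda] in [Lambda x] is [2 x / S] with [S = sum_i d_i / 3^(i+1)] in
   (0, 1], and if two such parameters are closer than [2 x 3^-n] then their
   codings share the first [n] digits. So it is enough to find many digit
   sequences of frequency [p], in a tree whose levels can be counted exactly.

   Cut the digits into blocks of a large length [L] and prescribe the number of
   twos in each block, always [floor (p L)] or [floor (p L) + 1], such that the
   first [n] blocks contain exactly [floor (p n L)] twos: the frequency is then
   [p] without any law of large numbers. As the mode of a binomial law of
   parameter [p] carries mass at least [1 / (L + 1)], for [s ln 3 < h(p, 1 - p)]
   and [L] large every block can be chosen in [M > 3^(s L)] ways.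

   Suppose now that sets [U_k] cover the parameters. Choose [n_k] such that
   [U_k] meets at most one cylinder of [n_k] blocks and [M^(-n_k)] is at most
   a constant times [diam U_k ^ s], up to a summable error. If
   [sum_k diam U_k ^ s] is small, then [sum_k M^(-n_k) < 1], and choosing the
   blocks one after the other, each time minimising the weight of the cylinders
   that are still compatible with the choice, gives a sequence which avoids all
   of them: a parameter not covered. *)
Require Import Defs.
From mathcomp Require Import all_boot all_order all_algebra.
From mathcomp Require Import all_classical all_reals all_analysis.
From mathcomp Require Import zify ring lra.

Set Implicit Arguments.
Unset Strict Implicit.
Unset Printing Implicit Defensive.

Import Order.TTheory GRing.Theory Num.Theory.
Local Open Scope ring_scope.
Import numFieldNormedType.Exports.
Local Open Scope classical_set_scope.

(** * Greedy choice of a sequence avoiding weighted cylinders *)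

Lemma greedy_step (R : realType) (m : nat) (w : nat -> R) (b : nat -> 'I_m.+1)
    (S : pred nat) (r : R) :
  (forall k, 0 <= w k) ->
  (\sum_(0 <= k <oo) (if S k then w k else 0)%:E < r%:E)%E ->
  exists j, (\sum_(0 <= k <oo) (if S k && (b k == j) then w k else 0)%:E
              < (r / m.+1%:R)%:E)%E.
Proof.
move=> w0 Sr; apply: contrapT => /forallNP noj.
move: Sr; apply/negP; rewrite -leNgt.
have -> : (\sum_(0 <= k <oo) (if S k then w k else 0)%:E)%E =
    (\sum_(j < m.+1) \sum_(0 <= k <oo)
        (if S k && (b k == j) then w k else 0)%:E)%E.
  rewrite -nneseries_sum; last by move=> i k _; rewrite lee_fin; case: ifP.
  apply: eq_eseriesr => k _; rewrite sumEFin; congr EFin.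
  case: (S k) => /=; last by rewrite big1.
  by rewrite -big_mkcond /= (big_pred1 (b k))// => j; rewrite eq_sym.
have -> : r%:E = (\sum_(j < m.+1) (r / m.+1%:R)%:E)%E.
  rewrite sumEFin sumr_const card_ord -[LHS]/(r%:E); congr EFin.
  by rewrite -[RHS]mulr_natr divfK// pnatr_eq0.
apply: lee_sum => j _; rewrite leNgt; apply/negP; exact: noj.
Qed.

(** Choosing the lightest letter at each step keeps the weight of the words still matched after [t]
    letters below [m.+1 ^- t]. A word [k] matched on all its [n k] letters would alone weigh
    [m.+1 ^- n k], a contradiction. *)
Lemma greedy_avoid (R : realType) (m : nat) (n : nat -> nat)
    (b : nat -> nat -> 'I_m.+1) :
  (\sum_(0 <= k <oo) (m.+1%:R ^- n k : R)%:E < 1)%E ->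
  exists a : nat -> 'I_m.+1,
    forall k, ~ (forall i, (i < n k)%N -> b k i = a i).
Proof.
move=> sum_lt1; pose w k : R := m.+1%:R ^- n k.
have w0 k : 0 <= w k by rewrite invr_ge0 exprn_ge0.
pose small t (S : pred nat) :=
  (\sum_(0 <= k <oo) (if S k then w k else 0)%:E < (m.+1%:R ^- t : R)%:E)%E.
have /choice[next nextP] : forall tS : nat * pred nat, exists j,
    small tS.1 tS.2 -> small tS.1.+1 [pred k | tS.2 k && (b k tS.1 == j)].
  move=> [t S] /=; have [sS|nS] := pselect (small t S); last by exists ord0.
  have [j jP] := greedy_step (b^~ t) w0 sS; exists j => _.
  by rewrite /small exprSr invfM mulrC; rewrite mulrC in jP.
pose fix S t : pred nat := if t is t'.+1 then
  [pred k | S t' k && (b k t' == next (t', S t'))] else predT.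
pose a t := next (t, S t).
have smallS t : small t (S t).
  elim: t => [|t IH]; last exact: (nextP (t, S t)).
  by rewrite /small /= expr0 invr1.
have S_agree k t : (forall i, (i < t)%N -> b k i = a i) -> S t k.
  elim: t => //= t IH H; rewrite IH ?H ?eqxx// => i it; apply: H.
  exact: ltnW.
exists a => k /S_agree Sk; have := smallS (n k); apply/negP; rewrite -leNgt.
have f0 i : (0 <= (if S (n k) i then w i else 0)%:E)%E.
  by rewrite lee_fin; case: ifP.
rewrite (@nneseriesD1 _ _ k)// Sk -[leLHS]adde0 leeD2l// nneseries_ge0//.
Qed.

(** * Hausdorff measure of separated families *)

Lemma exprn_lt_small (R : realType) (q e : R) :
  0 <= q < 1 -> 0 < e -> exists n, q ^+ n < e.
Proof.
move=> /andP[q0 q1] e0; have nq : `|q| < 1 by rewrite ger0_norm.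
have [N _ H] := cvgr_lt _ (cvg_expr nq) _ e0.
by exists N; exact: H (leqnn N).
Qed.

Lemma gt1_of_mul_powR (R : realType) (M rho s : R) :
  0 < rho < 1 -> 0 <= s -> 1 < M * rho `^ s -> 1 < M.
Proof.
move=> /andP[rho0 rho1] s0 Mrho.
have rhos_le1 : rho `^ s <= 1.
  have <- : (1 : R) `^ s = 1 by rewrite powR1.
  by apply: ge0_ler_powR; rewrite ?nnegrE ?(ltW rho0) ?(ltW rho1).
have M0 : 0 < M.
  rewrite -(pmulr_lgt0 _ (@powR_gt0 R rho s rho0)); exact: lt_trans Mrho.
by rewrite (lt_le_trans Mrho)// -[leRHS]mulr1 ler_pM2l.
Qed.

Lemma level_of_diam (R : realType) (m : nat) (c rho s d e : R) :
  0 < c -> 0 < rho < 1 -> 0 <= s -> 1 < m.+1%:R * rho `^ s ->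
  0 <= d < c -> 0 < e ->
  exists n, d < c * rho ^+ n /\
    m.+1%:R ^- n <= ((c * rho) `^ s)^-1 * d `^ s + e.
Proof.
move=> c0 rho01 s0 Mrho /andP[d0 dc] e0.
have [rho0 rho1] := andP rho01.
have M1 := gt1_of_mul_powR rho01 s0 Mrho.
have [->|dn0] := eqVneq d 0.
  have [|n nP] := @exprn_lt_small R m.+1%:R^-1 e _ e0.
    by rewrite invr_ge0 ler0n invf_lt1 ?ltr0n.
  exists n; split; first by rewrite mulr_gt0// exprn_gt0.
  rewrite -exprVn (le_trans (ltW nP))// lerDr mulr_ge0// ?invr_ge0 powR_ge0//.
have {dn0}d_gt0 : 0 < d by rewrite lt_neqAle eq_sym dn0.
pose P n := c * rho ^+ n <= d.
have exP : exists n, P n.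
  have [||n /ltW nP] := @exprn_lt_small R rho (d / c).
  - by rewrite ltW.
  - by rewrite divr_gt0.
  - by exists n; rewrite /P mulrC -ler_pdivlMr.
case: (ex_minnP exP) => -[|n] Pn minn.
  by move: Pn; rewrite /P expr0 mulr1 leNgt dc.
exists n; split.
  by rewrite ltNge; apply/negP => /minn; rewrite ltnn.
have rn0 : 0 <= rho ^+ n by rewrite exprn_ge0 ?ltW.
apply: (@le_trans _ _ ((rho ^+ n) `^ s)).
  have -> : (rho ^+ n) `^ s = (rho `^ s) ^+ n.
    by rewrite -!powR_mulrn ?powR_ge0 ?ltW// powRAC.
  rewrite -exprVn lerXn2r ?nnegrE ?powR_ge0 ?invr_ge0//.
  by rewrite -[leLHS]mul1r ler_pdivrMr ?ltr0n// mulrC ltW.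
have cr0 : 0 < c * rho by rewrite mulr_gt0.
rewrite -[leLHS]addr0 lerD ?(ltW e0)// mulrC ler_pdivlMr ?powR_gt0//.
rewrite -powRM// ?(ltW cr0)// ge0_ler_powR// ?nnegrE ?mulr_ge0 ?(ltW c0)
  ?(ltW rho0)//.
by rewrite mulrCA -exprSr.
Qed.

Lemma diam_ge0 (R : realType) (A : set R) : (0 <= diam A)%E.
Proof. by rewrite /diam le_max lexx. Qed.

Lemma le_diam (R : realType) (A : set R) (y z : R) :
  A y -> A z -> ((`|y - z|)%:E <= diam A)%E.
Proof.
move=> Ay Az; rewrite /diam le_max; apply/orP; right.
by apply: ereal_sup_ubound; exists (y, z).
Qed.

Lemma hausdorff_weight_ge0 (R : realType) (s : R) (A : set R) :
  (0 <= hausdorff_weight s A)%E.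
Proof. by rewrite /hausdorff_weight; case: ifP => // _; exact: poweR_ge0. Qed.

(** A mass distribution principle in which a greedy choice replaces the measure. *)
Lemma hausdorff_measure_neq0 (R : realType) (A : set R) (m : nat)
    (f : (nat -> 'I_m.+1) -> R) (c rho s : R) :
  0 < c -> 0 < rho < 1 -> 0 <= s -> 1 < m.+1%:R * rho `^ s ->
  (forall a, A (f a)) ->
  (forall a b n, `|f a - f b| < c * rho ^+ n ->
     forall i, (i < n)%N -> a i = b i) ->
  hausdorff_measure s A <> 0%E.
Proof.
move=> c0 rho01 s0 Mrho fA fsep HA0.
have rho0 : 0 < rho by case/andP: rho01.
have M1 := gt1_of_mul_powR rho01 s0 Mrho.
set C := ((c * rho) `^ s)^-1.
have C0 : 0 < C by rewrite invr_gt0 powR_gt0// mulr_gt0.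
(* Scale [c / 2] keeps the diameters below [c], as [level_of_diam] requires. After multiplication by
   [C] the cover costs at most [1/2], and the errors below add up to [1/4]. *)
have : (hausdorff_premeasure s (c / 2) A < (C^-1 / 2)%:E)%E.
  apply: (@le_lt_trans _ _ 0%E); last first.
    by rewrite lte_fin divr_gt0// invr_gt0.
  rewrite -HA0; apply: ereal_sup_ubound; exists (c / 2) => //=.
  by rewrite divr_gt0.
move=> /ereal_inf_lt[_ [U [AU Udiam] <-]] Usmall.
have /choice[n nP] : forall k, exists n : nat,
    (forall y z, U k y -> U k z -> `|y - z| < c * rho ^+ n) /\
    ((m.+1%:R ^- n)%:E <= C%:E * hausdorff_weight s (U k)
       + ((4^-1 : R) / (2 ^ k.+1)%:R)%:E)%E.
  move=> k.
  have e0 : 0 < (4^-1 : R) / (2 ^ k.+1)%:R.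
    by rewrite divr_gt0 ?invr_gt0// ltr0n expn_gt0.
  (* An empty [U k] has weight 0 even for [s = 0], so the error term alone must pay for its
     level. *)
  have [U0|Un0] := pselect (U k = set0).
    have [|n nP] := @exprn_lt_small R m.+1%:R^-1 _ _ e0.
      by rewrite invr_ge0 ler0n invf_lt1 ?ltr0n.
    exists n; split; first by rewrite U0.
    rewrite /hausdorff_weight; case: asboolP => // _.
    by rewrite mule0 add0e lee_fin -exprVn ltW.
  have dU : diam (U k) = (fine (diam (U k)))%:E.
    rewrite fineK// ge0_fin_numE ?diam_ge0//.
    exact: le_lt_trans (Udiam k) (ltry _).
  have dc : 0 <= fine (diam (U k)) < c.
    rewrite fine_ge0 ?diam_ge0//= -lte_fin -dU (le_lt_trans (Udiam k))//.
    by rewrite lte_fin ltr_pdivrMr// ltr_pMr// ltr1n.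
  have [n [dn nP]] := level_of_diam c0 rho01 s0 Mrho dc e0.
  exists n; split.
    move=> y z Uy Uz; apply: le_lt_trans dn.
    by rewrite -lee_fin -dU; exact: le_diam.
  rewrite /hausdorff_weight; case: asboolP => // _.
  by rewrite dU poweR_EFin -EFinM -EFinD lee_fin.
(* By separation, every [a] with [f a] in [U k] agrees with [b k] on the first [n k] letters. If
   there is none, any default will do. *)
have /choice[b bP] : forall k, exists b, (exists a, U k (f a)) -> U k (f b).
  move=> k; have [[a aU]|nU] := pselect (exists a, U k (f a)).
    by exists a.
  by exists (fun=> ord0).
have [|a aP] := @greedy_avoid R m n b.
  have w0 k : (0 <= C%:E * hausdorff_weight s (U k))%E.
    by rewrite mule_ge0 ?hausdorff_weight_ge0// lee_fin ltW.
  apply: (@le_lt_trans _ _ (\sum_(0 <= k <oo) (C%:E * hausdorff_weight s (U k)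
       + ((4^-1 : R) / (2 ^ k.+1)%:R)%:E))%E).
    apply: lee_nneseries => [k _ _|k _]; last by case: (nP k).
    by rewrite lee_fin invr_ge0 exprn_ge0.
  apply: (le_lt_trans (epsilon_trick _ w0 _)); first by rewrite invr_ge0.
  rewrite nneseriesZl; last by move=> *; exact: hausdorff_weight_ge0.
  apply: (@le_lt_trans _ _ (C%:E * (C^-1 / 2)%:E + (4^-1)%:E)%E).
    by rewrite leeD2r// lee_pmul2l// ltW.
  by rewrite -EFinM -EFinD lte_fin mulrA divff ?gt_eqF//; lra.
have [k _ Uk] := AU _ (fA a).
apply: (aP k); apply: fsep.
case: (nP k) => + _; apply=> //.
by apply: bP; exists a.
Qed.

(** * Ternary sums with digits 0 and 2 *)

Definition ternary (R : realType) (d : nat -> nat) : R ^nat :=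
  series (fun i => (d i)%:R / 3 ^+ i.+1 : R).

Lemma ternaryS (R : realType) (d : nat -> nat) (n : nat) :
  ternary R d n.+1 = ternary R d n + (d n)%:R / 3 ^+ n.+1.
Proof. by rewrite /ternary /series /= big_nat_recr. Qed.

Lemma ternary_nd (R : realType) (d : nat -> nat) :
  nondecreasing_seq (ternary R d).
Proof.
apply/nondecreasing_seqP => n.
by rewrite ternaryS lerDl divr_ge0// exprn_ge0.
Qed.

(** The digits from position [n] on contribute at most [3 ^- n], the value of an all-twos tail. *)
Lemma ternary_tail_ni (R : realType) (d : nat -> nat) : Omega d ->
  nonincreasing_seq (fun n => ternary R d n + 3 ^- n).
Proof.
move=> dO; apply/nonincreasing_seqP => n; rewrite ternaryS -addrA lerD2l.
have d2 : (d n)%:R <= (2 : R) by case: (dO n) => ->.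
have -> : (3 : R) ^- n = 3 / 3 ^+ n.+1.
  by rewrite exprS invfM mulrA divff// mul1r.
rewrite -[X in _ + X]mul1r -mulrDl ler_pM2r ?invr_gt0 ?exprn_gt0//.
by rewrite -lerBrDr; lra.
Qed.

Lemma ternary_cvg (R : realType) (d : nat -> nat) :
  Omega d -> cvgn (ternary R d).
Proof.
move=> dO; apply: nondecreasing_is_cvgn; first exact: ternary_nd.
exists 1 => _ [n _ <-].
have := ternary_tail_ni R dO (leq0n n).
rewrite {2}/ternary /series /= big_geq// expr0 invr1 add0r; apply: le_trans.
by rewrite lerDl invr_ge0 exprn_ge0.
Qed.

Lemma ternary_le_lim (R : realType) (d : nat -> nat) (n : nat) : Omega d ->
  ternary R d n <= limn (ternary R d).
Proof.
move=> dO; apply: nondecreasing_cvgn_le; first exact: ternary_nd.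
exact: ternary_cvg.
Qed.

Lemma lim_ternary_le (R : realType) (d : nat -> nat) (n : nat) : Omega d ->
  limn (ternary R d) <= ternary R d n + 3 ^- n.
Proof.
move=> dO; apply: limr_le; first exact: ternary_cvg.
exists n => // k /= nk; have := ternary_tail_ni R dO nk; apply: le_trans.
by rewrite lerDl invr_ge0 exprn_ge0.
Qed.

Lemma lim_ternary_le1 (R : realType) (d : nat -> nat) : Omega d ->
  limn (ternary R d) <= 1.
Proof.
move=> dO; apply: le_trans (lim_ternary_le R 0 dO) _.
by rewrite /ternary /series /= big_geq// expr0 invr1 add0r.
Qed.

Lemma lim_ternary_gt0 (R : realType) (d : nat -> nat) (n : nat) : Omega d ->
  (0 < d n)%N -> 0 < limn (ternary R d).
Proof.
move=> dO dn; apply: lt_le_trans (ternary_le_lim R n.+1 dO).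
rewrite ternaryS; apply: ltr_wpDl.
  have := ternary_nd R d (leq0n n).
  by rewrite {1}/ternary /series /= big_geq.
by rewrite divr_gt0 ?ltr0n// exprn_gt0.
Qed.

(** At the first differing digit [i] the sums gain [2 / 3 ^+ i.+1] and 0, while the tails can win
    back only [3 ^- i.+1]. The gap is thus at least [3 ^- i.+1 >= 3 ^- n]. *)
Lemma ternary_separation (R : realType) (d d' : nat -> nat) (n : nat) :
  Omega d -> Omega d' -> `|limn (ternary R d) - limn (ternary R d')| < 3 ^- n ->
  forall i, (i < n)%N -> d i = d' i.
Proof.
move=> dO d'O close i; have [k] := ubnP i.
elim: k i => // k IH i ik lin; have := ik; rewrite ltnS => ik'.
have {IH}agree j : (j < i)%N -> d j = d' j.
  by move=> ji; apply: IH; [exact: leq_trans ji _|exact: ltn_trans ji lin].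
have eqt : ternary R d i = ternary R d' i.
  by apply: eq_big_nat => j /= ji; rewrite agree.
wlog [di d'i] : d d' dO d'O close agree eqt / d i = 2%N /\ d' i = 0%N.
  move=> H; case: (dO i) (d'O i) => [di|di] [d'i|d'i]; rewrite ?di ?d'i//.
    have := H d' d d'O dO; rewrite di d'i => H'.
    apply/esym/H' => //; first by rewrite distrC.
    by move=> j ji; rewrite agree.
  by have := H d d' dO d'O; rewrite di d'i; apply.
have := close; rewrite ltNge => /negP[].
rewrite (le_trans _ (ler_norm _))//.
have h1 := ternary_le_lim R i.+1 dO; have h2 := lim_ternary_le R i.+1 d'O.
move: h1 h2; rewrite !ternaryS di d'i eqt mul0r addr0 => h1 h2.
apply: (@le_trans _ _ (3 ^- i.+1)); last by lra.
by rewrite lef_pV2 ?posrE ?exprn_gt0// ler_weXn2l// ler1n.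
Qed.

(** * The parameter determined by a digit sequence *)

Definition lambda_of (R : realType) (x : R) (d : nat -> nat) : R :=
  2 * x / limn (ternary R d).

Lemma coding_lambda_of (R : realType) (x : R) (d : nat -> nat) :
  0 < limn (ternary R d) -> x = coding (lambda_of x d) d.
Proof.
move=> S0; rewrite /coding /lambda_of -/(ternary R d) mulrAC divfK ?gt_eqF//.
by rewrite mulrAC divff// mul1r.
Qed.

Lemma lambda_of_in_Lambda (R : realType) (x : R) (d : nat -> nat) :
  0 < x -> Omega d -> 0 < limn (ternary R d) -> lambda_of x d \in Lambda x.
Proof.
move=> x0 dO S0; apply/mem_set; split.
  by rewrite divr_gt0// mulr_gt0.
by apply/mem_set; exists d => //; rewrite -coding_lambda_of.
Qed.

(** Two codings of [x] with the same parameter have equal ternary sums, so separation applies at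
    every level. *)
Lemma Phi_lambda_of (R : realType) (x : R) (d : nat -> nat) :
  0 < x -> Omega d -> 0 < limn (ternary R d) -> Phi x (lambda_of x d) = d.
Proof.
move=> x0 dO S0; apply: xget_unique => [|d' [d'O]].
  by split=> //; exact: coding_lambda_of.
rewrite {1}(coding_lambda_of x S0) /coding -!/(ternary R _).
have l0 : lambda_of x d / 2 != 0.
  by rewrite gt_eqF// divr_gt0// divr_gt0// mulr_gt0.
move=> /(mulfI l0) eqS; apply/funext => i.
apply: (@ternary_separation R _ _ i.+1) => //.
by rewrite eqS subrr normr0 invr_gt0 exprn_gt0.
Qed.

(* The limits [S, S'] are at most 1, so [x |S - S'| <= x |S - S'| / (S S')]. *)
Lemma lambda_of_separation (R : realType) (x : R) (d d' : nat -> nat)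
    (n : nat) :
  0 < x -> Omega d -> Omega d' ->
  0 < limn (ternary R d) -> 0 < limn (ternary R d') ->
  `|lambda_of x d - lambda_of x d'| < 2 * x * 3^-1 ^+ n ->
  forall i, (i < n)%N -> d i = d' i.
Proof.
move=> x0 dO d'O S0 S'0 close; apply: (@ternary_separation R) => //.
rewrite -(@ltr_pM2l _ (2 * x)) ?mulr_gt0// -exprVn; apply: le_lt_trans close.
set S := limn _ in S0 *; set S' := limn _ in S'0 *.
have SS'0 : 0 < S * S' by rewrite mulr_gt0.
have -> : lambda_of x d - lambda_of x d' = 2 * x * (S' - S) / (S * S').
  rewrite /lambda_of -/S -/S'; field.
  by rewrite !gt_eqF.
rewrite normrM normrM (gtr0_norm (x := 2 * x)) ?mulr_gt0//.
rewrite normfV (gtr0_norm SS'0) distrC ler_peMr ?mulr_ge0 ?(ltW x0)//.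
rewrite invf_ge1//; apply: mulr_ile1; by [exact: ltW|exact: lim_ternary_le1].
Qed.

(** * Binomial coefficients and entropy *)

(* The binomial(n, p) distribution is unimodal with mode at [floor ((n + 1) p)],
   hence its mode carries mass at least [1 / (n + 1)]. *)
Lemma binomial_mode (R : realType) (p : R) (n : nat) : 0 < p < 1 ->
  exists2 k : nat, (k <= n)%N /\ n%:R * p + p - 1 <= k%:R <= n%:R * p + p &
    n.+1%:R^-1 <= 'C(n, k)%:R * (p ^+ k * (1 - p) ^+ (n - k)).
Proof.
move=> /andP[p0 p1]; have q0 : 0 < 1 - p by rewrite subr_gt0.
pose t k : R := 'C(n, k)%:R * (p ^+ k * (1 - p) ^+ (n - k)).
(* The ratio of consecutive terms, cleared of denominators; comparing the largest term with its
   neighbours then locates it. *)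
have step k : (k < n)%N ->
    t k.+1 * (k.+1%:R * (1 - p)) = t k * ((n - k)%:R * p).
  move=> kn; have := mul_bin_left n k; move/(congr1 (fun j => j%:R : R)).
  rewrite !natrM /t => e.
  have -> : (n - k = (n - k.+1).+1)%N by rewrite subnSK.
  rewrite !exprS -[RHS]mulrA.
  transitivity ((k.+1%:R * 'C(n, k.+1)%:R) *
     (p * p ^+ k * (1 - p) ^+ (n - k.+1) * (1 - p))); first by ring.
  rewrite e -(subnSK kn); ring.
have tpos k : (k <= n)%N -> 0 < t k.
  by move=> kn; rewrite !mulr_gt0 ?exprn_gt0// ltr0n bin_gt0.
have [k _ kmax] := @arg_maxP _ _ _ (@ord0 n) predT (fun k : 'I_n.+1 => t k) isT.
have kn : (k <= n)%N by rewrite -ltnS.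
exists (k : nat).
  split=> //; apply/andP; split.
    have [kln|] := ltnP k n; last first.
      move=> nk; have -> : (k : nat) = n by apply/eqP; rewrite eqn_leq kn nk.
      have : 0 <= n%:R * (1 - p) by rewrite mulr_ge0// ltW.
      by lra.
    have := kmax (Ordinal (kln : (k.+1 < n.+1)%N)) isT => /= h.
    have := step _ kln => e.
    have : t k * ((n - k)%:R * p) <= t k * (k.+1%:R * (1 - p)).
      by rewrite -e ler_pM2r// mulr_gt0// ltr0n.
    by rewrite ler_pM2l ?tpos// natrB// -natr1; lra.
  case E : (k : nat) => [|j].
    by rewrite addr_ge0 ?(ltW p0)// mulr_ge0// ltW.
  have jn : (j < n)%N by rewrite -E.
  have := kmax (Ordinal (leq_trans jn (leqnSn n) : (j < n.+1)%N)) isT => /= h.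
  have := step _ jn; rewrite -E => e.
  have : t k * (k%:R * (1 - p)) <= t k * ((n - j)%:R * p).
    by rewrite e ler_pM2r// mulr_gt0// ltr0n subn_gt0.
  by rewrite ler_pM2l ?tpos// E natrB 1?ltnW// -natr1; lra.
(* The [n.+1] terms sum to 1, so the largest is at least their average. *)
rewrite -[leLHS]mul1r ler_pdivrMr ?ltr0n//.
have := exprDn (1 - p) p n; rewrite subrK expr1n => {1}->.
apply: (@le_trans _ _ (\sum_(i < n.+1) t k)).
  apply: ler_sum => i _; apply: le_trans (kmax i isT).
  by rewrite /t mulr_natl (mulrC (p ^+ i)).
by rewrite sumr_const card_ord mulr_natr.
Qed.

Lemma expR_ge_mul (R : realType) (e B : R) : 0 < e ->
  exists n : nat, (0 < n)%N /\ B * n%:R * n.+1%:R < expR (e * n%:R).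
Proof.
(* With [expR y >= 1 + y ^+ 3 / 6], the constant 12 yields [2 * |B| * n ^+ 2], which dominates
   [|B| * n * n.+1]. *)
move=> e0; pose n := (Num.truncn (12 * `|B| / e ^+ 3)).+1.
exists n; split=> //.
have nB : 12 * `|B| / e ^+ 3 < n%:R by exact: truncnS_gt.
have n1 : 1 <= n%:R :> R by rewrite ler1n.
have e3 : 0 < e ^+ 3 by rewrite exprn_gt0.
have en0 : 0 <= e * n%:R by rewrite mulr_ge0 ?(ltW e0).
apply: lt_le_trans (expR_ge1Dxn 2 en0).
apply: (@le_lt_trans _ _ (`|B| * n%:R * n.+1%:R)).
  by rewrite -!mulrA ler_wpM2r ?mulr_ge0// ler_norm.
move: nB; rewrite ltr_pdivrMr// => nB.
have B0 := normr_ge0 B.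
rewrite exprMn -natr1 (_ : (3`!)%N = 6%N)//.
set N := n%:R in n1 nB *.
have : 2 * `|B| * N ^+ 2 <= e ^+ 3 * N ^+ 3 / 6.
  rewrite ler_pdivlMr//.
  have -> : 2 * `|B| * N ^+ 2 * 6 = 12 * `|B| * N ^+ 2 by ring.
  have -> : e ^+ 3 * N ^+ 3 = N * e ^+ 3 * N ^+ 2 by ring.
  by rewrite ler_wpM2r ?sqr_ge0// ltW.
have : 0 <= `|B| * N * (N - 1) by rewrite !mulr_ge0 ?subr_ge0// (le_trans _ n1).
have -> : `|B| * N * (N - 1) = 2 * `|B| * N ^+ 2 - `|B| * N * (N + 1) by ring.
lra.
Qed.

(** The mode is one of the two admissible [k], and its coefficient is at least
    [expR (h * n) / (B * n.+1)] with [h] the entropy. Moving to the other [k] costs a factor of at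
    most [n], and the gap [h - t] absorbs these polynomial losses. *)
Lemma binomial_entropy (R : realType) (p t : R) :
  0 < p < 1 -> t < entropy p (1 - p) ->
  exists n : nat, (0 < n)%N /\
    forall k, (Num.truncn (p * n%:R) <= k <= (Num.truncn (p * n%:R)).+1)%N ->
      expR (t * n%:R) < 'C(n, k)%:R.
Proof.
move=> p01 tlt; have /andP[p0 p1] := p01.
have q0 : 0 < 1 - p by rewrite subr_gt0.
pose B := expR (- ln p - ln (1 - p)).
have [n [n0 nP]] := @expR_ge_mul R (entropy p (1 - p) - t) B
  ltac:(by rewrite subr_gt0).
exists n; split => // k; set k0 := Num.truncn _ => kk0.
have [j [jn /andP[jlo jhi]] jmass] := binomial_mode n p01.
have pn0 : 0 <= p * n%:R by rewrite mulr_ge0// ltW.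
have /andP[k0lo k0hi] := truncn_itv pn0; rewrite -/k0 in k0lo k0hi.
have jk0 : (k0 <= j <= k0.+1)%N.
  rewrite -ltnS; apply/andP; split.
    rewrite -(ltr_nat R) -natr1; lra.
  rewrite -ltnS -(ltr_nat R) -!natr1; rewrite -natr1 in k0hi; lra.
have Cj : expR (t * n%:R) * n%:R < 'C(n, j)%:R.
  set h := entropy p (1 - p) in tlt nP *.
  have weight_le : p ^+ j * (1 - p) ^+ (n - j) <= B * expR (- h * n%:R).
    rewrite -{1}(lnK (x := p)) ?posrE// -{1}(lnK (x := 1 - p)) ?posrE//.
    rewrite -!expRM_natl -!expRD ler_expR natrB// /h /entropy.
    have lp : ln p < 0 by rewrite ln_lt0 ?p0.
    have lq : ln (1 - p) < 0 by rewrite ln_lt0// q0 gtrBl.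
    rewrite -subr_ge0; set P := ln p in lp *; set Q := ln (1 - p) in lq *.
    (* [B = 1 / (p (1 - p))] compensates for [j] being up to 1 away from [p n]. *)
    have -> : - P - Q + - (- p * P - (1 - p) * Q) * n%:R
        - (j%:R * P + (n%:R - j%:R) * Q) =
      - P * (1 + (j%:R - n%:R * p)) + - Q * (1 - (j%:R - n%:R * p)) by ring.
    by rewrite addr_ge0// mulr_ge0 ?oppr_ge0 ?(ltW lp) ?(ltW lq)//; lra.
  have n10 : 0 < n.+1%:R :> R by rewrite ltr0n.
  have C0 : 0 < 'C(n, j)%:R :> R by rewrite ltr0n bin_gt0.
  have {}jmass : 1 <= 'C(n, j)%:R * (B * expR (- h * n%:R)) * n.+1%:R.
    rewrite -ler_pdivrMr// div1r (le_trans jmass)// ler_pM2l//.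
  have tn0 : 0 < expR (t * n%:R) * n%:R by rewrite mulr_gt0 ?expR_gt0 ?ltr0n.
  move: jmass; rewrite -(ler_pM2l tn0) mulr1 => /le_lt_trans; apply.
  rewrite [ltLHS](_ : _ = 'C(n, j)%:R * (B * n%:R * n.+1%:R *
    (expR (t * n%:R) * expR (- h * n%:R)))); last by ring.
  rewrite -[ltRHS]mulr1 ltr_pM2l// -expRD.
  rewrite (_ : t * _ + _ = - ((h - t) * n%:R)); last by ring.
  by rewrite expRN -ltr_pdivlMr ?invr_gt0 ?expR_gt0// invrK mul1r.
have k0n : (k0 < n)%N.
  rewrite -(ltr_nat R); apply: le_lt_trans k0lo _.
  by rewrite gtr_pMl// ltr0n.
have Ck : 'C(n, j)%:R <= 'C(n, k)%:R * n%:R :> R.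
  rewrite -natrM ler_nat.
  have := mul_bin_left n k0.
  have b1 : (k0.+1 * 'C(n, k0.+1) <= n * 'C(n, k0.+1))%N.
    by rewrite leq_mul2r k0n orbT.
  have b2 : ((n - k0) * 'C(n, k0) <= n * 'C(n, k0))%N.
    by rewrite leq_mul2r leq_subr orbT.
  have b3 : ('C(n, k0.+1) <= k0.+1 * 'C(n, k0.+1))%N by rewrite leq_pmull.
  have b4 : ('C(n, k0) <= (n - k0) * 'C(n, k0))%N.
    by rewrite leq_pmull// subn_gt0.
  have [->|->] : j = k0 \/ j = k0.+1 by lia.
    have [->|->] : k = k0 \/ k = k0.+1 by lia.
      by rewrite leq_pmulr.
    by rewrite mulnC; lia.
  have [->|->] : k = k0 \/ k = k0.+1 by lia.
    by rewrite mulnC; lia.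
  by rewrite leq_pmulr.
by rewrite -(@ltr_pM2r _ n%:R) ?ltr0n//; exact: lt_le_trans Ck.
Qed.

(** * Digit sequences built from blocks *)

Lemma injection_into_draws (T : finType) (k m : nat) :
  (m <= 'C(#|T|, k))%N ->
  exists f : 'I_m -> {set T}, injective f /\ forall j, #|f j| = k.
Proof.
rewrite -card_draws => mC.
exists (fun j => enum_val (widen_ord mC j)); split.
  by move=> i j /enum_val_inj/(congr1 val) /= ij; apply: val_inj.
by move=> j; have := enum_valP (widen_ord mC j); rewrite inE => /eqP.
Qed.

Lemma count_set_ord (L n : nat) (A : {set 'I_L.+1}) (P : pred nat) :
  (forall i : 'I_L.+1, P (n + i)%N = (i \in A)) ->
  count P (iota n L.+1) = #|A|.
Proof.
move=> PA; rewrite -[n in iota n]addn0 iotaDl count_map -val_enum_ord count_map.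
rewrite -sum1_count -sum1_card big_enum_cond /=.
by apply: eq_bigl => i; rewrite /= PA.
Qed.

Lemma digit_blocks (L m : nat) (kappa : nat -> nat) :
  (forall n, (m.+1 <= 'C(L.+1, kappa n))%N) ->
  exists D : (nat -> 'I_m.+1) -> nat -> nat,
  [/\ forall a, Omega (D a),
      forall a n,
        count (fun i => D a i == 2%N) (iota (n * L.+1) L.+1) = kappa n &
      forall a b n, (forall i, (i < n * L.+1)%N -> D a i = D b i) ->
        forall i, (i < n)%N -> a i = b i].
Proof.
move=> mC.
have /choice[F FP] : forall n, exists f : 'I_m.+1 -> {set 'I_L.+1},
    injective f /\ forall j, #|f j| = kappa n.
  by move=> n; apply: injection_into_draws; rewrite card_ord.
(* [F n j] is the set of positions of the twos in block [n] when its letter is [j]; injectivity of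
   [F n] lets the digits determine the letter. *)
pose D (a : nat -> 'I_m.+1) i :=
  if inord (i %% L.+1)%N \in F (i %/ L.+1)%N (a (i %/ L.+1)%N) then 2%N
  else 0%N.
have DE a n (i : 'I_L.+1) :
    D a (n * L.+1 + i)%N = if i \in F n (a n) then 2%N else 0%N.
  by rewrite /D modnMDl modn_small// inord_val divnMDl// divn_small// addn0.
exists D; split.
- by move=> a i; rewrite /D; case: ifP; [right|left].
- move=> a n; have [_ /(_ (a n)) <-] := FP n.
  by apply: count_set_ord => i; rewrite DE; case: ifP.
- move=> a b n agree i ni; have [Finj _] := FP i; apply: Finj; apply/setP => j.
  have := agree (i * L.+1 + j)%N; rewrite !DE.
  have lt : (i * L.+1 + j < n * L.+1)%N.
    apply: (@leq_trans (i.+1 * L.+1)); rewrite ?leq_mul2r ?ni ?orbT//.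
    by rewrite mulSn addnC ltn_add2r.
  by move=> /(_ lt); do 2 case: ifP.
Qed.

(** * Digit frequencies from bounded discrepancy *)

Lemma has_freq_of_bounded (R : realType) (j : nat) (d : nat -> nat) (p B : R) :
  (forall n, `|(count (fun k => d k == j) (iota 0 n))%:R - n%:R * p| <= B) ->
  has_freq j d p.
Proof.
move=> dB; apply/cvgrPdist_lt => e e0.
exists (Num.truncn (B / e)).+1 => // n /= Bn.
have n0 : 0 < n%:R :> R by rewrite ltr0n (leq_trans _ Bn).
rewrite distrC -(@ltr_pM2r _ n%:R)// -{2}(gtr0_norm n0) -normrM mulrBl
  divfK ?gt_eqF//.
rewrite (mulrC p); apply: le_lt_trans (dB n) _.
rewrite mulrC -ltr_pdivrMr// (lt_le_trans (truncnS_gt _))//.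
by rewrite ler_nat.
Qed.

Lemma truncnD_le (R : realType) (y z : R) : 0 <= y -> 0 <= z ->
  (Num.truncn y + Num.truncn z <= Num.truncn (y + z)
     <= (Num.truncn y + Num.truncn z).+1)%N.
Proof.
move=> y0 z0; have yz0 : 0 <= y + z by rewrite addr_ge0.
have /andP[y1 y2] := truncn_itv y0; have /andP[z1 z2] := truncn_itv z0.
have /andP[s1 s2] := truncn_itv yz0.
rewrite -!natr1 in y2 z2 s2.
apply/andP; split; rewrite -ltnS -(ltr_nat R) -!natr1 natrD; lra.
Qed.

(* [kappa n] is [floor (p (n + 1) L) - floor (p n L)] for blocks of length [L]. *)
Lemma balanced_blocks (R : realType) (p : R) (L : nat) : 0 < p < 1 ->
  exists kappa : nat -> nat,
    (forall n, (Num.truncn (p * L.+1%:R) <= kappa n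
                  <= (Num.truncn (p * L.+1%:R)).+1)%N) /\
    forall d, Omega d ->
      (forall n,
        count (fun i => d i == 2%N) (iota (n * L.+1) L.+1) = kappa n) ->
      has_freq 2 d p /\ has_freq 0 d (1 - p).
Proof.
move=> /andP[p0 p1].
pose K n := Num.truncn (p * (n * L.+1)%:R : R).
have pos n : 0 <= p * n%:R by rewrite mulr_ge0// ltW.
have KS n : (K n + Num.truncn (p * L.+1%:R) <= K n.+1
     <= (K n + Num.truncn (p * L.+1%:R)).+1)%N.
  rewrite /K mulSn addnC natrD mulrDr; exact: truncnD_le.
exists (fun n => K n.+1 - K n)%N; split.
  by move=> n; have /andP[h1 h2] := KS n; apply/andP; split; lia.
move=> d dO dK; pose c n := count (fun i => d i == 2%N) (iota 0 n).
have cD m n : c (m + n)%N = (c m + count (fun i => d i == 2%N) (iota m n))%N.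
  by rewrite /c iotaD count_cat add0n.
have cK n : c (n * L.+1)%N = K n.
  elim: n => [|n IH]; first by rewrite /K mul0n mulr0 truncn0.
  rewrite mulSn addnC cD IH dK; have /andP[h1 _] := KS n; lia.
(* Rounding in the complete blocks costs at most 1, the unfinished block at most [L.+1]. *)
have c_bound n : `|(c n)%:R - n%:R * p| <= L.+2%:R.
  rewrite (divn_eq n L.+1) cD cK.
  set r := (n %% L.+1)%N; set q := (n %/ L.+1)%N.
  have rL : r%:R <= L.+1%:R :> R by rewrite ler_nat ltnW// ltn_mod.
  have cr : (count (fun i => d i == 2%N) (iota (q * L.+1) r))%:R <= r%:R :> R.
    by rewrite ler_nat (leq_trans (count_size _ _))// size_iota.
  have cr0 :
      0 <= (count (fun i => d i == 2%N) (iota (q * L.+1) r))%:R :> R by [].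
  have /andP[h1 h2] := truncn_itv (pos (q * L.+1)%N); rewrite -/(K q) in h1 h2.
  have rp : 0 <= r%:R * p <= r%:R.
    by rewrite mulr_ge0 ?(ltW p0)//= ler_piMr// ltW.
  have /andP[rp0 rp1] := rp.
  rewrite -natr1 in h2; rewrite !natrD mulrDl (mulrC _ p) -[L.+2%:R]natr1.
  by rewrite ler_norml; apply/andP; split; lra.
split; first exact: has_freq_of_bounded c_bound.
apply: has_freq_of_bounded => n.
suff -> : (count (fun k => d k == 0%N) (iota 0 n))%:R - n%:R * (1 - p) =
    - ((c n)%:R - n%:R * p) by rewrite normrN; exact: c_bound.
have : (count (fun k => d k == 0%N) (iota 0 n) + c n)%N = n.
  rewrite -[RHS](size_iota 0) -(count_predC (fun k => d k == 0%N)).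
  congr addn; apply: eq_count => k /=.
  by case: (dO k) => ->.
by move=> /(congr1 (fun j => j%:R : R)); rewrite natrD; lra.
Qed.

(** * The dimension bound for [Lambda_freq p x] *)

Theorem theorem1p4 (R : realType) (x : R) (hx : 0 < x)
    (p : R) (hp0 : 0 < p) (hp1 : p < 1) :
  ((entropy p (1 - p) / ln 3)%:E <= hausdorff_dim (Lambda_freq p x))%E.
Proof.
have p01 : 0 < p < 1 by rewrite hp0.
apply: le_ereal_inf_tmp => _ [s [s0 Hs] <-]; rewrite lee_fin leNgt; apply/negP.
have ln3 : 0 < ln 3 :> R by rewrite ln_gt0// ltr1n.
rewrite ltr_pdivlMr// => /(binomial_entropy p01)[[|L] [n0 binL]] //.
have [kappa [kappaP freqP]] := balanced_blocks L p01.
set k0 := Num.truncn _ in binL kappaP.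
(* The minimum lets all blocks share one alphabet, whichever of the two counts of twos is
   prescribed. *)
pose M := minn 'C(L.+1, k0) 'C(L.+1, k0.+1).
have M_gt : expR (s * ln 3 * L.+1%:R) < M%:R.
  by rewrite /M; case: leqP => _; apply: binL; rewrite !leqnn leqnSn.
have M0 : (0 < M)%N by rewrite -(ltr_nat R) (lt_trans _ M_gt)// expR_gt0.
have [|D [DO Dcount Dinj]] := @digit_blocks L M.-1 kappa.
  move=> n; rewrite prednK// /M; have := kappaP n; move: (kappa n) => k kk0.
  have [->|->] : k = k0 \/ k = k0.+1 by lia.
    exact: geq_minl.
  exact: geq_minr.
have Dfreq a := freqP _ (DO a) (Dcount a).
(* Without any digit 2 the frequency would be 0, not [p]. *)
have limD_gt0 a : 0 < limn (ternary R (D a)).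
  have [freq2 _] := Dfreq a; rewrite ltNge; apply/negP => lim_le0.
  have Da0 i : D a i = 0%N.
    case: (DO a i) => // Di; move: lim_le0; rewrite leNgt => /negP[].
    by apply: (@lim_ternary_gt0 R _ i); rewrite ?Di.
  suff p_eq0 : p = 0 by move: hp0; rewrite p_eq0 ltxx.
  rewrite -(cvg_lim _ freq2)//; apply: cvg_lim => //.
  have -> : (fun n =>
      (count (fun k => D a k == 2%N) (iota 0 n))%:R / n%:R : R) = cst 0.
    apply/funext => n; rewrite (@eq_count _ _ pred0) ?count_pred0 ?mul0r//.
    by move=> k; rewrite /= Da0.
  exact: cvg_cst.
(* One letter is a block of [L.+1] digits, hence the ratio [3^-1 ^+ L.+1]; [2 * x] is the constant
   of [lambda_of_separation]. *)
apply: (@hausdorff_measure_neq0 R _ M.-1 (fun a => lambda_of x (D a))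
  (2 * x) (3^-1 ^+ L.+1) s _ _ s0 _ _ _ Hs).
- by rewrite mulr_gt0.
- rewrite exprn_gt0 ?invr_gt0//= exprn_ilt1//.
  by rewrite invf_lt1// ltr1n.
- rewrite prednK// /powR gt_eqF ?exprn_gt0 ?invr_gt0//.
  rewrite lnXn ?invr_gt0// lnV ?posrE//.
  have -> : s * (- ln 3 *+ L.+1) = - (s * ln 3 * L.+1%:R).
    by rewrite -mulr_natr; ring.
  by rewrite expRN -ltr_pdivrMr ?invr_gt0 ?expR_gt0// invrK mul1r.
- move=> a; have [freq2 freq0] := Dfreq a.
  split; first exact: lambda_of_in_Lambda.
    by rewrite Phi_lambda_of.
  by rewrite Phi_lambda_of.
- move=> a b n close; apply: Dinj; rewrite mulnC.
  apply: (@lambda_of_separation R x) => //.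
  by rewrite exprM.
Qed.
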